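(* Let $\lambda\in\mathbb Z_{\ge0}^N$, $|\lambda|=n$, $I\in\mathcal I_\lambda$. For $1\le l\le N-1$ and $1\le a\le\lambda^{(l)}$ (with $\lambda^{(0)}=0$, $\lambda^{(N)}=n$) the weight function $W_I(t,z,\Pi)$ satisfies $$W_I(\dots,pt^{(l)}_a,\dots,z,\Pi)=(-1)^{\lambda^{(l+1)}+\lambda^{(l-1)}}W_I(\dots,t^{(l)}_a,\dots,z,\Pi),$$ \begin{align*}&W_I(\dots,e^{-2\pi i}t^{(l)}_a,\dots,z,\Pi)=(-e^{-\pi i\tau})^{\lambda^{(l+1)}+\lambda^{(l-1)}}\\&\times\exp\Big\{-\frac{2\pi i}r\Big((\lambda^{(l+1)}+\lambda^{(l-1)})v^{(l)}_a-\sum_{b=1}^{\lambda^{(l+1)}}v^{(l+1)}_b-\sum_{c=1}^{\lambda^{(l-1)}}v^{(l-1)}_c-(P+h)_{l,l+1}-\lambda_{l+1}\Big)\Big\}\\&\times W_I(\dots,t^{(l)}_a,\dots,z,\Pi).\end{align*}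
   Context: **Theta function.** $0<|q|<1$ (branch of $\log q$ fixed), $r$ a generic positive real, $p=q^{2r}$, $\tau$ defined by $p=e^{-2\pi i/\tau}$ (i.e. $2r\log q=-2\pi i/\tau$); $[u]=q^{u^2/r-u}\Theta_p(q^{2u})$, $\Theta_p(z)=(z;p)_\infty(p/z;p)_\infty(p;p)_\infty$, $(x;p)_\infty=\prod_{n\ge0}(1-xp^n)$. One has $[u+r]=-[u]$, $[u+r\tau]=-e^{-\pi i\tau}e^{-2\pi iu/r}[u]$. **Combinatorics.** $\mathcal I_\lambda$ is the set of partitions $I=(I_1,\dots,I_N)$ of $\{1,\dots,n\}$ with $|I_l|=\lambda_l$; $\mu_i=l\Leftrightarrow i\in I_l$. $\lambda^{(l)}=\lambda_1+\cdots+\lambda_l$, $I^{(l)}=I_1\cup\cdots\cup I_l=\{i^{(l)}_1<\cdots<i^{(l)}_{\lambda^{(l)}}\}$. **Variables.** $t=(t^{(l)}_a)_{1\le l\le N-1,\,1\le a\le\lambda^{(l)}}$, $t^{(l)}_a=q^{2v^{(l)}_a}$, $z_k=q^{2u_k}$, $v^{(N)}_k=u_k$; functions of $t$ are regarded as functions of the $v$'s: $t^{(l)}_a\mapsto pt^{(l)}_a$ means $v^{(l)}_a\mapsto v^{(l)}_a+r$, and $t^{(l)}_a\mapsto e^{-2\pi i}t^{(l)}_a$ means $v^{(l)}_a\mapsto v^{(l)}_a+r\tau$. Generic dynamical parameters $(P+h)_{j,k}$ with $(P+h)_{j,k}+(P+h)_{k,l}=(P+h)_{j,l}$; $\Pi_{j,k}=q^{2(P+h)_{j,k}}$.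 $C_{\mu_s,l+1}(s)=\sum_{j=s+1}^n(\delta_{\mu_j,\mu_s}-\delta_{\mu_j,l+1})$. **Weight functions.** $W_I(t,z,\Pi)=\mathrm{Sym}_{t^{(1)}}\cdots\mathrm{Sym}_{t^{(N-1)}}U_I(t,z,\Pi)$, where $\mathrm{Sym}_{t^{(l)}}$ is the sum over all permutations of $t^{(l)}_1,\dots,t^{(l)}_{\lambda^{(l)}}$ and \begin{align*}U_I=\prod_{l=1}^{N-1}\prod_{a=1}^{\lambda^{(l)}}\Bigg(&\frac{[v^{(l+1)}_b-v^{(l)}_a+(P+h)_{\mu_s,l+1}-C_{\mu_s,l+1}(s)][1]}{[(P+h)_{\mu_s,l+1}-C_{\mu_s,l+1}(s)]}\Bigg|_{i^{(N)}_s=i^{(l+1)}_b=i^{(l)}_a}\\&\times\prod_{\substack{b=1\\ i^{(l+1)}_b>i^{(l)}_a}}^{\lambda^{(l+1)}}[v^{(l+1)}_b-v^{(l)}_a]\prod_{\substack{b=1\\ i^{(l+1)}_b<i^{(l)}_a}}^{\lambda^{(l+1)}}[v^{(l+1)}_b-v^{(l)}_a+1]\prod_{b=a+1}^{\lambda^{(l)}}\frac{[v^{(l)}_b-v^{(l)}_a+1]}{[v^{(l)}_b-v^{(l)}_a]}\Bigg)\end{align*} (in the first factor $b,s$ are the indices determined by $i^{(N)}_s=s=i^{(l+1)}_b=i^{(l)}_a$). *)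

(* Defs.v *)
From mathcomp Require Import all_boot all_order all_fingroup all_algebra.

Set Implicit Arguments.
Unset Strict Implicit.
Unset Printing Implicit Defensive.

Import Order.TTheory GRing.Theory Num.Theory.

(* Conventions.
   - Colours 1, ..., N are coded by 'I_N: the ordinal k stands for colour k + 1.
     At level l (a natural number, 1 <= l <= N - 1) the colour l + 1 is thus the
     ordinal l.  Positions 1, ..., n and variable indices are likewise coded
     from 0.
   - The variables are v : forall l, 'I_(psum lam l) -> R[i]; v l is the family
     v^(l), and v N is the family u of the u_k.  Levels above N are never read. *)

Section Combinatorics.
Variables (N n : nat) (lam : 'I_N -> nat).

(* lambda^(l) = lambda_1 + ... + lambda_l, which is |lambda| for l >= N *)
Definition psum (l : nat) : nat := (\sum_(k < N | (k < l)%N) lam k)%N.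

(* The set I_lambda *)
Record opart := OPart {
  block : 'I_N -> {set 'I_n};
  block_card : forall k, #|block k| = lam k;
  block_disj : forall k l, k != l -> [disjoint block k & block l];
  block_cover : forall s, [exists k, s \in block k] }.

Definition mu (I : opart) (s : 'I_n) : 'I_N :=
  xchoose (existsP (block_cover I s)).

Lemma muP (I : opart) (s : 'I_n) (k : 'I_N) :
  (mu I s == k) = (s \in block I k).
Proof.
have hs : s \in block I (mu I s).
  exact: (xchooseP (existsP (block_cover I s))).
apply/eqP/idP => [<- // | hk].
apply/eqP; apply: contraT => ne.
by have /disjointFr/(_ hs) := block_disj I ne; rewrite hk.
Qed.

Definition upto (I : opart) (l : nat) : {set 'I_n} :=
  \bigcup_(k < N | (k < l)%N) block I k.

Lemma in_upto (I : opart) (l : nat) (s : 'I_n) :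
  (s \in upto I l) = (mu I s < l)%N.
Proof.
apply/bigcupP/idP => [[k hk]|hl]; first by rewrite -muP => /eqP ->.
by exists (mu I s); rewrite // -muP.
Qed.

Lemma card_upto (I : opart) (l : nat) : #|upto I l| = psum l.
Proof.
rewrite -sum1_card (partition_big (mu I) (fun k : 'I_N => (k < l)%N)) /=.
  apply: eq_bigr => k hk; rewrite sum1dep_card -(block_card I) -cardsE.
  apply: eq_card => s; rewrite !inE in_upto -muP.
  by case: eqP => [->|]; rewrite ?hk ?andbF.
by move=> s; rewrite in_upto.
Qed.

(* i^(l)_a: enum_val lists the elements of upto I l in increasing order *)
Definition idx (I : opart) (l : nat) (a : 'I_(psum l)) : 'I_n :=
  enum_val (cast_ord (esym (card_upto I l)) a).

End Combinatorics.

From mathcomp Require Import all_classical all_reals all_analysis.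
From mathcomp Require Export complex.

Import numFieldNormedType.Exports.

Local Open Scope classical_set_scope.
Local Open Scope ring_scope.
Local Open Scope complex_scope.

(* (x; p)_oo *)
Definition qpoch (K : numFieldType) (x p : K) : K :=
  lim ((fun m : nat => \prod_(k < m) (1 - x * p ^+ k)) @ \oo).

Section Theta.
Variable R : realType.

Definition cexp (x : R[i]) : R[i] :=
  (expR (complex.Re x))%:C *
  ((cos (complex.Im x))%:C + 'i * (sin (complex.Im x))%:C).

Definition ipi : R[i] := 'i * (pi : R)%:C.

(* q ^ x for the fixed branch logq of log q *)
Definition qpow (logq x : R[i]) : R[i] := cexp (x * logq).

Definition Theta (p z : R[i]) : R[i] :=
  qpoch z p * qpoch (p / z) p * qpoch p p.

Definition nome (logq : R[i]) (r : R) : R[i] := qpow logq (2 * r%:C).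

(* The bracket [u] *)
Definition brk (logq : R[i]) (r : R) (u : R[i]) : R[i] :=
  qpow logq (u ^+ 2 / r%:C - u) * Theta (nome logq r) (qpow logq (2 * u)).

End Theta.

Section Weight.
Variables (R : realType) (logq : R[i]) (r : R).
Variables (N n : nat) (lam : 'I_N -> nat) (I : opart n lam).
(* P j k is (P+h)_{j+1,k+1} *)
Variable P : 'I_N -> 'I_N -> R[i].

Local Notation vars := (forall l : nat, 'I_(psum lam l) -> R[i]).
Local Notation "\[ u ]" := (brk logq r u) (at level 0, format "\[ u ]").
Local Notation mu := (mu I).
Local Notation idx := (idx I).

(* C_{mu_s,l+1}(s), the ordinal l coding the colour l + 1 *)
Definition Cshift (l : 'I_N) (s : 'I_n) : R[i] :=
  \sum_(j < n | (s < j)%N) ((mu j == mu s)%:R - (mu j == l)%:R).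

(* (P+h)_{mu_s,l+1} - C_{mu_s,l+1}(s) *)
Definition dyn (l : 'I_N) (s : 'I_n) : R[i] := P (mu s) l - Cshift l s.

(* The first product over b has exactly one factor, since I^(l) is contained
   in I^(l+1). *)
Definition weightU (v : vars) : R[i] :=
  \prod_(l < N | (0 < l)%N) \prod_(a < psum lam l)
    ((\prod_(b < psum lam l.+1 | idx b == idx a)
        (\[v l.+1 b - v l a + dyn l (idx a)] * \[1] / \[dyn l (idx a)]))
     * (\prod_(b < psum lam l.+1 | (idx a < idx b)%N) \[v l.+1 b - v l a])
     * (\prod_(b < psum lam l.+1 | (idx b < idx a)%N) \[v l.+1 b - v l a + 1])
     * (\prod_(b < psum lam l | (a < b)%N)
          (\[v l b - v l a + 1] / \[v l b - v l a]))).

Definition Symt (l : nat) (F : vars -> R[i]) (v : vars) : R[i] :=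
  \sum_(sigma : 'S_(psum lam l)) F (eqtype.dfwith v (fun a => v l (sigma a))).

Definition weight : vars -> R[i] := foldr Symt weightU (iota 1 N.-1).

(* Genericity: no denominator in the formula for W_I vanishes (division is
   total, with 0^-1 = 0). *)
Definition weight_regular (v : vars) : Prop :=
  forall l : 'I_N, (0 < l)%N ->
    (forall a : 'I_(psum lam l), \[dyn l (idx a)] != 0) /\
    (forall a b : 'I_(psum lam l), a != b -> \[v l b - v l a] != 0).

End Weight.

(* v^(l)_a replaced by v^(l)_a + c, all other variables unchanged *)
Definition shift_var (R : realType) (N : nat) (lam : 'I_N -> nat)
    (v : forall l : nat, 'I_(psum lam l) -> R[i])
    (l : nat) (a : 'I_(psum lam l)) (c : R[i]) :
    forall l : nat, 'I_(psum lam l) -> R[i] :=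
  eqtype.dfwith v (fun b : 'I_(psum lam l) => if b == a then v l b + c else v l b).

(* Main.v *)
Require Import Defs.
From mathcomp Require Import all_boot all_order all_fingroup all_algebra.
From mathcomp Require Import all_classical all_reals all_analysis.
From mathcomp Require Import ring zify.

Set Implicit Arguments.
Unset Strict Implicit.
Unset Printing Implicit Defensive.

Import Order.TTheory GRing.Theory Num.Theory.
Import numFieldNormedType.Exports.

Local Open Scope ring_scope.
Local Open Scope complex_scope.

(** The bracket is quasi-periodic under both shifts of the theorem: for s = r and
for s = r tau one has [u + s] = kap E(u) [u] with a constant kap and a character
E of the additive group (kap = -1, E = 1 in the first case; kap = - e^(- pi i tau),
E(u) = e^(- 2 pi i u / r) in the second).  This rests on the convergence of the
infinite products in Theta_p, which gives Theta_p(p z) = - z^(-1) Theta_p(z), and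
on q^(2 r tau) = e^(- 2 pi i) = 1.  From E(s) = kap^2 one gets the mirror rule
[u - s] = kap E(-u) [u], so that a product of brackets in which a variable
occurs with coefficient 1 or -1 picks up one kap per occurrence and E of a signed
sum of arguments ([qp_shift], [qp_shiftB]).

In U_I the variable v^(l)_a meets every v^(l+1)_b and every v^(l-1)_c exactly
once, whence the power of kap; its occurrences at level l come in quotients
[x + 1] / [x], whose kap's cancel and which contribute E(1) or E(-1).  The shift
of the arguments by 0, 1 or a dynamical parameter depends on I and on the
position i^(l)_a, but the total does not: it is always
- (P+h)_{l,l+1} - lambda_{l+1}.  This is [dynamical_balance], where the counts of
positions left and right of i^(l)_a compensate C_{mu_s,l+1}(s) and, when
mu_s < l, the cocycle relation of P combines the parameters of two consecutive
levels.

So all U_I have the same multiplier, and this multiplier is symmetric in each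
group of variables.  Permuting the variables and then shifting one of them is
shifting one variable and then permuting ([permute_shift]); hence each
symmetrization keeps the transformation law ([Symt_shift]). *)

(** * Convergence of the q-Pochhammer symbol *)

(** Peels off the first factor; the limit of the remaining ones has to exist, since
[lim] of a divergent sequence is arbitrary. *)
Lemma qpoch_step_of_cvg (K : numFieldType) (x p : K) :
  cvgn (fun m => \prod_(k < m) (1 - x * p * p ^+ k) : K) ->
  qpoch x p = (1 - x) * qpoch (x * p) p.
Proof.
move=> /cvg_ex[y py].
have -> : qpoch (x * p) p = y by apply: (@cvg_lim K (@norm_hausdorff K K)).
apply: (@cvg_lim K (@norm_hausdorff K K)); rewrite -cvg_shiftS /=.
have -> : (fun m => \prod_(k < m.+1) (1 - x * p ^+ k))
        = (fun m => (1 - x) * \prod_(k < m) (1 - x * p * p ^+ k)).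
  apply/funext => m; rewrite big_ord_recl expr0 mulr1; congr (_ * _).
  by apply: eq_bigr => k _; rewrite /= /bump /= add1n exprS mulrA.
exact: cvgMl_tmp.
Qed.

Section Pochhammer.
Variable R : realType.

Let C : numFieldType := R[i].

Lemma cvgn_geometric_steps (f : nat -> R) (c rho : R) :
  0 <= c -> 0 <= rho < 1 -> (forall m, `|f m.+1 - f m| <= c * rho ^+ m) ->
  cvgn f.
Proof.
move=> c0 /andP[rho0 rho1] step.
have -> : f = (fun n => f 0%N + series (telescope f) n).
  by apply/funext => n; rewrite -eq_sum_telescope.
apply: is_cvgD; first exact: is_cvg_cst.
apply: normed_cvg; apply: (@series_le_cvg _ _ (geometric c rho)) => //.
- by move=> n; rewrite /= normr_ge0.
- by move=> n; apply: geometric_ge0.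
- by apply: is_cvg_geometric_series; rewrite ger0_norm.
Qed.

(** Reduces convergence in the complex numbers to the completeness of the reals. *)
Lemma complex_cvgn (f : nat -> C) :
  cvgn (fun m => complex.Re (f m)) -> cvgn (fun m => complex.Im (f m)) ->
  cvgn f.
Proof.
have embed (g : nat -> R) : cvgn g -> cvgn (fun m => (g m)%:C : C).
  move=> /cvg_ex[y gy]; apply/cvg_ex; exists y%:C.
  apply/cvgrPdist_lt => e; rewrite ltcE /= => /andP[/eqP e0 e1].
  have -> : e = (complex.Re e)%:C by case: e e0 {e1} => ? ? /= ->.
  move/cvgrPdist_lt/(_ _ e1): gy; apply: filterS => m.
  by rewrite -rmorphB normc_def /= expr0n addr0 sqrtr_sqr ltcR.
move=> fr fi.
have -> : f = (fun m => (complex.Re (f m))%:C + 'i%C * (complex.Im (f m))%:C).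
  by apply/funext => m; rewrite -complexE.
apply: is_cvgD; first exact: embed.
by apply: is_cvgMl_tmp; exact: embed.
Qed.

Definition qpoch_part (x p : R[i]) (m : nat) : C := \prod_(k < m) (1 - x * p ^+ k).

(** By 1 + t <= e^t the partial products are at most e^(|x| / (1 - |p|)). *)
Lemma qpoch_part_bounded (x p : R[i]) : `|p| < 1 ->
  exists c : R, forall m, `|qpoch_part x p m| <= c%:C.
Proof.
move=> p1.
pose nx := complex.Re `|x|; pose np := complex.Re `|p|.
have Ex : `|x| = nx%:C by rewrite /nx normc_def.
have Ep : `|p| = np%:C by rewrite /np normc_def.
have nx0 : 0 <= nx by rewrite -ler0c -Ex.
have np0 : 0 <= np by rewrite -ler0c -Ep.
have np1 : np < 1 by rewrite -ltcR -Ep.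
exists (expR (nx / (1 - np))) => m.
rewrite /qpoch_part normr_prod.
apply: (@le_trans _ _ (\prod_(k < m) (expR (nx * np ^+ k))%:C)).
  apply: ler_prod => k _; rewrite normr_ge0 /=.
  apply: le_trans (ler_normB _ _) _; rewrite normr1 normrM normrX Ex Ep.
  by rewrite -rmorphXn -rmorphM -(rmorph1 (real_complex R)) -rmorphD lecR expR_ge1Dx.
rewrite -rmorph_prod -expR_sum lecR ler_expR -mulr_sumr ler_wpM2l //.
have np1' : 1 - np != 0 by rewrite subr_eq0 eq_sym lt_eqF.
have d0 : 0 < 1 - np by rewrite subr_gt0.
have : (1 - np) * \sum_(k < m) np ^+ k = 1 - np ^+ m.
  rewrite -[in RHS](expr1n _ m) subrXX; congr (_ * _).
  by apply: eq_bigr => k _; rewrite expr1n mul1r.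
move=> /(congr1 (fun z => (1 - np)^-1 * z)); rewrite mulKf // => ->.
by rewrite ler_piMr ?invr_ge0 ?(ltW d0) // gerBl exprn_ge0.
Qed.

(** Consecutive partial products differ by -x p^m times a bounded factor, so they
converge like a geometric series. *)
Lemma qpoch_cvg (x p : R[i]) : `|p| < 1 -> cvgn (qpoch_part x p).
Proof.
move=> p1; have [c hc] := qpoch_part_bounded x p1.
pose np := complex.Re `|p|.
have Ep : `|p| = np%:C by rewrite /np normc_def.
pose nx := complex.Re `|x|.
have Ex : `|x| = nx%:C by rewrite /nx normc_def.
have nx0 : 0 <= nx by rewrite -ler0c -Ex.
have np01 : 0 <= np < 1 by rewrite -ler0c -ltcR -Ep normr_ge0 p1.
have c0 : 0 <= c by rewrite -ler0c; exact: le_trans (hc 0%N).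
have step m : `|qpoch_part x p m.+1 - qpoch_part x p m| <= (c * nx * np ^+ m)%:C.
  have -> : qpoch_part x p m.+1 - qpoch_part x p m = - (qpoch_part x p m * (x * p ^+ m)).
    by rewrite /qpoch_part big_ord_recr /=; ring.
  have -> : (c * nx * np ^+ m)%:C = c%:C * (`|x| * `|p| ^+ m).
    by rewrite Ex Ep !rmorphM rmorphXn mulrA.
  by rewrite normrN !normrM normrX ler_wpM2r // mulr_ge0 ?exprn_ge0.
have cnx0 : 0 <= c * nx by rewrite mulr_ge0.
apply: complex_cvgn; apply: (cvgn_geometric_steps cnx0 np01) => m;
  rewrite -lecR; apply: le_trans (step m); rewrite -raddfB /=.
- exact: normc_ge_Re.
- rewrite normc_def lecR -sqrtr_sqr ler_wsqrtr // lerDr sqr_ge0 //.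
Qed.

Lemma qpoch_step (x p : C) : `|p| < 1 ->
  qpoch x p = (1 - x) * qpoch (x * p) p.
Proof. by move=> p1; apply: qpoch_step_of_cvg; exact: qpoch_cvg. Qed.

(** Multiplying z by p removes the factor 1 - z from (z; p) and adds the factor
1 - 1/z to (p/z; p); peeling off factors instead of dividing by 1 - z covers z = 1. *)
Lemma Theta_shift (p z : R[i]) : `|p| < 1 -> p != 0 -> z != 0 ->
  Theta p (z * p) = - z^-1 * Theta p z.
Proof.
move=> p1 p0 z0; rewrite /Theta.
have -> : p / (z * p) = z^-1 by field; rewrite z0 p0.
rewrite (qpoch_step z) // (qpoch_step z^-1) // [z^-1 * p]mulrC.
by field; rewrite z0.
Qed.

End Pochhammer.

(** * The exponential and the quasi-periods of the bracket *)

Section Bracket.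
Variable R : realType.

Lemma gt0_real_complex_neq0 (r : R) : 0 < r -> r%:C != 0 :> R[i].
Proof.
by move=> r0; rewrite -(rmorph0 (real_complex R)) (inj_eq (@complexI _)) gt_eqF.
Qed.

Lemma cexpD (x y : R[i]) : cexp (x + y) = cexp x * cexp y.
Proof.
case: x y => [a b] [c d]; rewrite /cexp /= expRD cosD sinD.
rewrite rmorphM rmorphB !rmorphD !rmorphM /= -!complexiE.
have := sqr_i R; set j := 'i%C => j2.
by ring: j2.
Qed.

Lemma cexp0 : cexp 0 = 1 :> R[i].
Proof. by rewrite /cexp /= expR0 cos0 sin0 mulr0 addr0 mulr1. Qed.

Lemma cexp_neq0 (x : R[i]) : cexp x != 0.
Proof.
apply/eqP => x0; have := cexpD x (- x).
by rewrite subrr cexp0 x0 mul0r => /eqP; rewrite oner_eq0.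
Qed.

Lemma cexpN (x : R[i]) : cexp (- x) = (cexp x)^-1.
Proof.
by apply: (mulfI (cexp_neq0 x)); rewrite -cexpD subrr cexp0 divff ?cexp_neq0.
Qed.

Lemma norm_cexp (x : R[i]) : `|cexp x| = (expR (complex.Re x))%:C.
Proof.
have -> : cexp x = Complex (expR (complex.Re x) * cos (complex.Im x))
                           (expR (complex.Re x) * sin (complex.Im x)).
  by rewrite [RHS]complexE /= /cexp complexiE !rmorphM /=; ring.
rewrite normc_def /= !exprMn -mulrDr cos2Dsin2 mulr1 sqrtr_sqr.
by rewrite ger0_norm ?expR_ge0.
Qed.

Lemma cexp_ipi : cexp (ipi R) = -1.
Proof.
rewrite /cexp /ipi -complexiE.
have -> : 'i%C * (pi : R)%:C = Complex 0 (pi : R).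
  by rewrite [RHS]complexE /= rmorph0 add0r.
by rewrite /= expR0 cospi sinpi rmorph0 mulr0 addr0 mul1r rmorphN rmorph1.
Qed.

(** The real part of log q is negative, and p is the exponential of 2 r log q. *)
Lemma norm_nome (logq : R[i]) (r : R) : `|cexp logq| < 1 -> 0 < r ->
  `|nome logq r| < 1.
Proof.
move=> + r0; rewrite /nome /qpow !norm_cexp.
rewrite -!(rmorph1 (real_complex R)) !ltcR !expR_lt1 => h.
have -> : complex.Re (2 * r%:C * logq) = 2 * r * complex.Re logq.
  rewrite -(rmorph_nat (real_complex R) 2) -rmorphM.
  by case: (logq) => x y; rewrite /= mul0r subr0.
by rewrite nmulr_llt0 // mulr_gt0.
Qed.

(** The prefactor of [u + r] is q^(2u) times that of [u], and q^(2u) cancels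
against the factor - q^(-2u) produced by the theta function. *)
Lemma brk_shift_r (logq : R[i]) (r : R) (u : R[i]) :
  `|nome logq r| < 1 -> 0 < r ->
  brk logq r (u + r%:C) = - brk logq r u.
Proof.
move=> p1 r0; rewrite /brk.
have rn0 := gt0_real_complex_neq0 r0.
have -> : qpow logq (2 * (u + r%:C)) = qpow logq (2 * u) * nome logq r.
  by rewrite /nome /qpow -cexpD; congr cexp; ring.
rewrite Theta_shift // ?cexp_neq0 //.
have -> : qpow logq ((u + r%:C) ^+ 2 / r%:C - (u + r%:C))
        = qpow logq (u ^+ 2 / r%:C - u) * qpow logq (2 * u).
  by rewrite /qpow -cexpD; congr cexp; field.
have := cexp_neq0 (2 * u * logq); rewrite -/(qpow logq (2 * u)) => z0.
by field.
Qed.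

(** Since r tau log q = - pi i, the theta function is unchanged, and the whole
factor comes from the quadratic exponent of the prefactor. *)
Lemma brk_shift_tau (logq tau : R[i]) (r : R) (u : R[i]) :
  2 * r%:C * logq = - (2 * ipi R) / tau -> logq != 0 -> 0 < r ->
  brk logq r (u + r%:C * tau)
  = - cexp (- (ipi R * tau)) * cexp (- (2 * ipi R / r%:C) * u) * brk logq r u.
Proof.
move=> htau lq0 r0; rewrite /brk.
have rn0 := gt0_real_complex_neq0 r0.
have t0 : tau != 0.
  apply/eqP => t0; move: htau; rewrite t0 invr0 mulr0 => /eqP.
  by rewrite !mulf_eq0 (negPf rn0) (negPf lq0) pnatr_eq0.
have hlt : r%:C * tau * logq = - ipi R.
  apply: (@mulfI _ 2); first by rewrite pnatr_eq0.
  by rewrite mulrA [2 * _]mulrA mulrAC htau; field.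
have -> : qpow logq (2 * (u + r%:C * tau)) = qpow logq (2 * u).
  rewrite /qpow; have -> : 2 * (u + r%:C * tau) * logq = 2 * u * logq - ipi R - ipi R.
    by rewrite -hlt; ring.
  by rewrite !cexpD cexpN cexp_ipi invrN1 mulrN1 mulrN1 opprK.
rewrite [RHS]mulrA; congr (_ * Theta _ _); rewrite /qpow.
have -> : ((u + r%:C * tau) ^+ 2 / r%:C - (u + r%:C * tau)) * logq
   = - (ipi R * tau) + - (2 * ipi R / r%:C) * u + ipi R + (u ^+ 2 / r%:C - u) * logq.
  have -> : ipi R = - (r%:C * tau * logq) by rewrite hlt opprK.
  by field.
by rewrite !cexpD cexp_ipi mulrN1 !mulNr.
Qed.

End Bracket.

(** * Products of quasi-periodic functions *)

Section QuasiPeriod.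
Variable K : fieldType.

(** The value E(s) = kap^2 is what [f (u + s) = kap * E u * f u] forces for a
nonzero odd or even f; it makes the rules for u + s and u - s mirror images. *)
Record quasi_period (f : K -> K) (s kap : K) (E : K -> K) : Prop := QuasiPeriod {
  qp_E0 : E 0 = 1;
  qp_ED : forall x y, E (x + y) = E x * E y;
  qp_neq0 : kap != 0;
  qp_sqr : E s = kap ^+ 2;
  qp_shift : forall u, f (u + s) = kap * E u * f u }.

Variables (f : K -> K) (s kap : K) (E : K -> K).

Lemma qp_EN : quasi_period f s kap E -> forall x, E x * E (- x) = 1.
Proof. by move=> qp x; rewrite -(qp_ED qp) subrr (qp_E0 qp). Qed.

Lemma qp_E_sum (I : Type) (t : seq I) (Q : pred I) (g : I -> K) :
  quasi_period f s kap E ->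
  \prod_(i <- t | Q i) E (g i) = E (\sum_(i <- t | Q i) g i).
Proof. by move=> qp; rewrite (big_morph E (qp_ED qp) (qp_E0 qp)). Qed.

Lemma qp_shiftB : quasi_period f s kap E ->
  forall u, f (u - s) = kap * E (- u) * f u.
Proof.
move=> qp u; have k0 := qp_neq0 qp.
have := qp_shift qp (u - s); rewrite subrK => ->.
have -> : kap * E (- u) * (kap * E (u - s) * f (u - s))
        = kap ^+ 2 * (E (- u) * E (u - s)) * f (u - s) by ring.
by rewrite -(qp_ED qp) addKr -(qp_sqr qp) (qp_EN qp) mul1r.
Qed.

(** Here x stands for the variables of one level, y for those of the next one, and c
for what is added to the differences inside the brackets. *)
Definition grid m n (x : 'I_m -> K) (y : 'I_n -> K) (c : 'I_m -> 'I_n -> K) : K :=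
  \prod_(a < m) \prod_(b < n) f (y b - x a + c a b).

Definition shift_at m (x : 'I_m -> K) (a : 'I_m) : 'I_m -> K :=
  fun b => if b == a then x b + s else x b.

Lemma grid_shift_lower m n x y c (a : 'I_m) : quasi_period f s kap E ->
  grid (shift_at x a) y c
  = kap ^+ n * E (\sum_(b < n) (x a - y b - c a b)) * grid (n := n) x y c.
Proof.
move=> qp; rewrite /grid (bigD1 a) // [in RHS](bigD1 a) //= mulrA; congr (_ * _).
  rewrite -(qp_E_sum _ _ _ qp) -[in kap ^+ n](card_ord n) -prodr_const -!big_split /=.
  apply: eq_bigr => b _; rewrite /shift_at eqxx.
  have -> : y b - (x a + s) + c a b = (y b - x a + c a b) - s by ring.
  by rewrite (qp_shiftB qp); congr (_ * E _ * _); ring.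
by apply: eq_bigr => a' /negPf na; apply: eq_bigr => b _; rewrite /shift_at na.
Qed.

Lemma grid_shift_upper m n x y c (b : 'I_n) : quasi_period f s kap E ->
  grid x (shift_at y b) c
  = kap ^+ m * E (\sum_(a < m) (y b - x a + c a b)) * grid (m := m) x y c.
Proof.
move=> qp; rewrite /grid -(qp_E_sum _ _ _ qp) -[in kap ^+ m](card_ord m).
rewrite -prodr_const -!big_split /=; apply: eq_bigr => a _.
rewrite (bigD1 b) // [in RHS](bigD1 b) //= mulrA; congr (_ * _).
  rewrite /shift_at eqxx -(qp_shift qp); congr f; ring.
by apply: eq_bigr => b' /negPf nb; rewrite /shift_at nb.
Qed.

Definition ratios m (x : 'I_m -> K) : K :=
  \prod_(a < m) \prod_(b < m | (a < b)%N) (f (x b - x a + 1) / f (x b - x a)).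

(** Each quotient [x + 1] / [x] with x = x_b - x_a, a < b, changes by E(1) when x_b
is shifted and by E(-1) when x_a is: the constants kap cancel. *)
Lemma ratios_shift m x (a : 'I_m) : quasi_period f s kap E ->
  ratios (shift_at x a)
  = E (\sum_(b < m) ((b < a)%N%:R - (a < b)%N%:R)) * ratios x.
Proof.
move=> qp; have k0 := qp_neq0 qp.
have E0 u : E u != 0.
  by apply/eqP => Eu; have /eqP := qp_EN qp u; rewrite Eu mul0r eq_sym oner_eq0.
have cancel e d u w : e != 0 -> kap * (e * d) * u / (kap * e * w) = d * (u / w).
  by move=> e0; rewrite invfM; move: w^-1 => w'; field; rewrite k0 e0.
(* g i j is the coefficient of s in x j - x i after the shift *)
pose g (i j : 'I_m) : K := (j == a)%:R - (i == a)%:R.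
have step (i j : 'I_m) : (i < j)%N ->
    f (shift_at x a j - shift_at x a i + 1) / f (shift_at x a j - shift_at x a i)
  = E (g i j) * (f (x j - x i + 1) / f (x j - x i)).
  move=> ij; rewrite /shift_at /g.
  case: (eqVneq j a) => [ja|_]; case: (eqVneq i a) => [ia|_].
  - by move: ij; rewrite ja ia ltnn.
  - have -> : x j + s - x i + 1 = x j - x i + 1 + s by ring.
    have -> : x j + s - x i = x j - x i + s by ring.
    by rewrite !(qp_shift qp) subr0 (qp_ED qp) cancel.
  - have -> : x j - (x i + s) + 1 = x j - x i + 1 - s by ring.
    have -> : x j - (x i + s) = x j - x i - s by ring.
    by rewrite !(qp_shiftB qp) sub0r opprD (qp_ED qp) cancel.
  - by rewrite subrr (qp_E0 qp) mul1r.
transitivity (\prod_(i < m) \prod_(j < m | (i < j)%N)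
    (E (g i j) * (f (x j - x i + 1) / f (x j - x i)))).
  by apply: eq_bigr => i _; apply: eq_bigr => j; exact: step.
under eq_bigr do rewrite big_split /= (qp_E_sum _ _ _ qp).
rewrite big_split /= (qp_E_sum _ _ _ qp); congr (E _ * _).
rewrite /g; under [LHS]eq_bigr do rewrite sumrB.
rewrite !sumrB; congr (_ - _).
  apply: eq_bigr => i _; rewrite big_mkcond (bigD1 a) //= eqxx big1.
    by rewrite addr0; case: ifP.
  by move=> j /negPf ->; case: ifP.
rewrite (bigD1 a) //= [X in _ + X]big1 => [|i /negPf ia].
  by rewrite addr0 big_mkcond; apply: eq_bigr => j _; rewrite eqxx; case: ifP.
by apply: big1 => j _; rewrite ia.
Qed.

End QuasiPeriod.

(** * Positions and the dynamical parameters *)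

Section Positions.
Variables (N n : nat) (lam : 'I_N -> nat) (I : opart n lam).

(** Positions are compared by their values in 'I_n, variables by their indices; the
increasing enumeration makes both orders agree. *)
Lemma enum_val_set_ltn (A : {set 'I_n}) (i j : 'I_#|A|) :
  (enum_val i < enum_val j)%N = (i < j)%N.
Proof.
have srt : sorted (relpre val ltn) (enum A).
  rewrite /enum_mem; apply: sorted_filter; first by move=> x y z; exact: ltn_trans.
  by rewrite -enumT -sorted_map val_enum_ord iota_ltn_sorted.
have mono (i' j' : 'I_#|A|) : (i' < j')%N -> (enum_val i' < enum_val j')%N.
  move=> lt; have x0 := enum_val i'.
  rewrite !(enum_val_nth x0).
  apply: (sorted_ltn_nth _ _ srt) => //; rewrite ?inE -?cardE //.
  by move=> x y z; exact: ltn_trans.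
case: (ltngtP i j) => [/mono //|/mono lt|/val_inj ->]; last by rewrite ltnn.
by rewrite ltnNge (ltnW lt).
Qed.

Lemma idx_ltn l (a b : 'I_(psum lam l)) : (idx I a < idx I b)%N = (a < b)%N.
Proof. exact: enum_val_set_ltn. Qed.

Lemma mu_idx l (a : 'I_(psum lam l)) : (mu I (idx I a) < l)%N.
Proof. by rewrite -in_upto; exact: enum_valP. Qed.

Lemma sum_idx (V : nmodType) l (g : 'I_n -> V) :
  \sum_(a < psum lam l) g (idx I a) = \sum_(x in upto I l) g x.
Proof.
rewrite [RHS]big_enum_val /= [RHS](reindex (cast_ord (esym (card_upto I l)))) //.
by apply: onW_bij; exists (cast_ord (card_upto I l)) => a; rewrite ?cast_ordK ?cast_ordKV.
Qed.

Lemma sum_split_at (V : nmodType) (A : {set 'I_n}) (y : 'I_n) (D : V) (g : 'I_n -> V) :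
  g y = 0 ->
  \sum_(x in A) (if x == y then D else g x)
  = (if y \in A then D else 0) + \sum_(x in A) g x.
Proof.
move=> gy; rewrite big_mkcond [in RHS]big_mkcond /= (bigD1 y) //= [in RHS](bigD1 y) //=.
rewrite eqxx gy if_same add0r; congr (_ + _).
by apply: eq_bigr => x /negPf ->.
Qed.

Section Dynamical.
Variables (R : realType) (P : 'I_N -> 'I_N -> R[i]).
Hypothesis hP : forall i j m : 'I_N, P i j + P j m = P i m.

Lemma lam_sum (l : 'I_N) : (lam l)%:R = \sum_(x < n) (mu I x == l)%:R :> R[i].
Proof.
rewrite -(block_card I l) -sum1_card natr_sum big_mkcond /=.
by apply: eq_bigr => x _; rewrite muP; case: ifP.
Qed.

(** The argument offsets met by the variable at position y, summed over the upper
level, the lower level and its own level, do not depend on y.  All terms except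
the parameters P are sums over positions x, and these sums cancel for each x
separately: to the left of y the upper level and the own level differ by
[mu x = l], to the right the own level and the lower one differ by [mu x = k], which
the Cshift terms replace by [mu x = l]; together they count lam l. *)
Lemma dynamical_balance (k l : 'I_N) (y : 'I_n) : l = k.+1 :> nat ->
  (mu I y < l)%N ->
  - (\sum_(x in upto I l.+1) (if x == y then dyn I P l y else (x < y)%N%:R))
  + \sum_(x in upto I k) (if x == y then dyn I P k y else (y < x)%N%:R)
  + \sum_(x in upto I l) ((x < y)%N%:R - (y < x)%N%:R)
  = - P k l - (lam l)%:R.
Proof.
move=> hkl muy; rewrite !sum_split_at ?ltnn // !in_upto ltnS (ltnW muy).
rewrite lam_sum /dyn /Cshift.
have mul x : (mu I x == l) = (mu I x == k.+1 :> nat) by rewrite -val_eqE /= hkl.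
have muk x : (mu I x == k) = (mu I x == k :> nat) by [].
pose T (x : 'I_n) : R[i] :=
  (if (y < x)%N then (mu I x == mu I y)%:R - (mu I x == l)%:R else 0)
  - (if x \in upto I l.+1 then (x < y)%N%:R else 0)
  - (if (y < x)%N then
       if (mu I y < k)%N then (mu I x == mu I y)%:R - (mu I x == k)%:R else 0 else 0)
  + (if x \in upto I k then (y < x)%N%:R else 0)
  + (if x \in upto I l then (x < y)%N%:R - (y < x)%N%:R else 0)
  + (mu I x == l)%:R.
have sumT : \sum_(x < n) T x = 0.
  apply: big1 => x _; rewrite /T !in_upto !mul !muk -!val_eqE /= hkl.
  rewrite hkl in muy.
  case: (ltngtP x y) => [xy|xy|/val_inj ->].
  - by rewrite [(_ < k.+2)%N]ltnS leq_eqVlt; case: (ltngtP (mu I x) k.+1) => _ /=;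
      rewrite ?subr0 ?sub0r ?add0r ?addr0 ?mulr0n ?mulr1n ?addNr //;
      rewrite if_same ?addr0 ?addNr.
  - rewrite ltnS leq_eqVlt in muy; rewrite [(_ < k.+1)%N]ltnS leq_eqVlt.
    (* mu y = k leaves only the Cshift term of level l, mu y < k also that of level k *)
    case/orP: muy => [/eqP -> | muy]; rewrite ?ltnn ?muy.
      by case: (ltngtP (mu I x) k) => _ /=; rewrite ?mulr0n ?mulr1n ?if_same;
        move: (_ == k.+1)%:R => t; ring.
    by case: (ltngtP (mu I x) k) => _ /=; rewrite ?mulr0n ?mulr1n ?if_same;
      move: (_ == k.+1)%:R (_ == nat_of_ord (mu I y))%:R => t t'; ring.
  - by rewrite (ltn_eqF muy) subrr !if_same !subr0 !addr0.
have hPkl : P (mu I y) k - P (mu I y) l = - P k l by rewrite -(hP (mu I y) k l); ring.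
rewrite /T !(big_split, sumrN) /= -!big_mkcond /= in sumT.
case: ifP sumT => [_|muk'] sumT; rewrite -[RHS]addr0 -[X in _ = _ + X]sumT.
  by rewrite -hPkl; ring.
have -> : mu I y = k by apply/val_inj => /=; lia.
by rewrite [X in _ - X + _ + _ + _]big1 //; ring.
Qed.

End Dynamical.
End Positions.

(** * The weight function *)

Section Weight.
Variables (R : realType) (logq : R[i]) (r : R).
Variables (N n : nat) (lam : 'I_N -> nat) (I : opart n lam).
Variable P : 'I_N -> 'I_N -> R[i].

Local Notation br := (brk logq r).
Local Notation vars := (forall l : nat, 'I_(psum lam l) -> R[i]).

(** The three kinds of brackets between consecutive levels differ only in what is
added to v^(l+1)_b - v^(l)_a, which allows one product over all pairs (a, b). *)
Definition offset (j : 'I_N) (a : 'I_(psum lam j)) (b : 'I_(psum lam j.+1)) : R[i] :=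
  if idx I b == idx I a then dyn I P j (idx I a) else (idx I b < idx I a)%N%:R.

(** The weight U_I with an arbitrary function f as bracket and with the factors free
of v collected in d; keeping f abstract makes quasi-periodicity all that is known of it. *)
Definition level_prod (f : R[i] -> R[i]) (d : 'I_N -> R[i]) (v : vars) : R[i] :=
  \prod_(j < N | (0 < j)%N)
    (grid f (v j) (v j.+1) (offset (j := j)) * d j * ratios f (v j)).

Section Shift.
Variables (f : R[i] -> R[i]) (s kap : R[i]) (E : R[i] -> R[i]).
Hypothesis qp : quasi_period f s kap E.
Hypothesis hP : forall i j m : 'I_N, P i j + P j m = P i m.

(** The argument of E in the common multiplier of all terms of W_I under the shift of
v^(l)_a, with k = l - 1. *)
Definition exponent (k l : 'I_N) (v : vars) (a : 'I_(psum lam l)) : R[i] :=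
  (psum lam l.+1 + psum lam k)%:R * v l a
  - \sum_(b < psum lam l.+1) v l.+1 b - \sum_(c < psum lam k) v k c
  - P k l - (lam l)%:R.

(** Only levels l and l - 1 involve the shifted variable; at level l - 1 it is an
upper variable, at level l a lower one and part of the quotients. *)
Lemma level_prod_shift (d : 'I_N -> R[i]) (k l : 'I_N) (v : vars) (a : 'I_(psum lam l)) :
  l = k.+1 :> nat ->
  level_prod f d (shift_var v a s)
  = kap ^+ (psum lam l.+1 + psum lam k) * E (exponent k v a)
    * level_prod f d v.
Proof.
case: l a => l' hl a /= hkl; subst l'; set l := Ordinal hl.
set w := shift_var v a s.
have wl : w k.+1 = shift_at s (v k.+1) a by rewrite /w /shift_var (dfwith_in v).
have wo j : j != k.+1 -> w j = v j.
  by move=> jl; rewrite /w /shift_var (dfwith_out v) // eq_sym.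
rewrite /level_prod (bigD1 l) //= [in RHS](bigD1 l) //=.
rewrite wl wo ?(neq_ltn, ltnSn, orbT) //.
rewrite (grid_shift_lower _ _ _ _ qp) (ratios_shift _ _ qp).
(* multiplier of level k; it is 1 for k = 0, where no such level exists *)
pose B := kap ^+ psum lam k
  * E (\sum_(c < psum lam k) (v k.+1 a - v k c + offset (j := k) c a)).
have rest : \prod_(j < N | (0 < j)%N && (j != l))
    (grid f (w j) (w j.+1) (offset (j := j)) * d j * ratios f (w j))
  = B * \prod_(j < N | (0 < j)%N && (j != l))
    (grid f (v j) (v j.+1) (offset (j := j)) * d j * ratios f (v j)).
  transitivity (\prod_(j < N | (0 < j)%N && (j != l)) ((if j == k then B else 1) *
    (grid f (v j) (v j.+1) (offset (j := j)) * d j * ratios f (v j)))).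
    apply: eq_bigr => j /andP[_ jl]; rewrite (wo j); last by rewrite -val_eqE in jl.
    case: eqVneq => [-> | jk].
      by rewrite wl (grid_shift_upper _ _ _ _ qp) /B; ring.
    by rewrite wo ?mul1r // eqSS.
  rewrite big_split /=; congr (_ * _); rewrite -big_mkcondr /=.
  have kl : k != l by rewrite -val_eqE /= neq_ltn ltnSn.
  have [k0|k0] := posnP k.
    have e0 : psum lam k = 0%N by rewrite /psum k0 big_pred0.
    rewrite big_pred0; last first.
      by move=> j; apply/negP => /andP[/andP[j0 _] /eqP jk]; rewrite jk k0 in j0.
    rewrite /B big1 ?(qp_E0 qp) ?mulr1 ?e0 // => c _.
    by have := ltn_ord c; rewrite [X in (_ < X)%N]e0.
  rewrite (big_pred1 k) // => j /=.
  by case: (eqVneq j k) => [->|]; rewrite ?k0 ?kl ?andbF.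
rewrite rest /B exprD.
have -> : exponent k (l := l) v a
  = \sum_(b < psum lam k.+2) (v k.+1 a - v k.+2 b - offset (j := l) a b)
    + \sum_(b < psum lam k.+1) ((b < a)%N%:R - (a < b)%N%:R)
    + \sum_(c < psum lam k) (v k.+1 a - v k c + offset (j := k) c a).
  have bal := dynamical_balance hP (y := idx I a) (k := k) (l := l) erefl (mu_idx I a).
  rewrite -!sum_idx in bal.
  have offk : \sum_(c < psum lam k) offset (j := k) c a
    = \sum_(c < psum lam k)
        (if idx I c == idx I a then dyn I P k (idx I a) else (idx I a < idx I c)%N%:R).
    by apply: eq_bigr => c _; rewrite /offset eq_sym; case: eqVneq => [->|].
  have ord_idx : \sum_(b < psum lam k.+1) ((b < a)%N%:R - (a < b)%N%:R : R[i])
    = \sum_(b < psum lam k.+1)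
        ((idx I b < idx I a)%N%:R - (idx I a < idx I b)%N%:R).
    by apply: eq_bigr => b _; rewrite !idx_ltn.
  have cst m (x : R[i]) : \sum_(b < m) x = m%:R * x.
    by rewrite sumr_const card_ord mulr_natl.
  rewrite /exponent -addrA -bal ord_idx ![in RHS](big_split, sumrN) /= offk !cst natrD.
  rewrite /offset ![in LHS](big_split, sumrN) /=; ring.
by rewrite !(qp_ED qp); ring.
Qed.

Definition permute (v : vars) (j : nat) (sigma : 'S_(psum lam j)) : vars :=
  eqtype.dfwith v (fun a => v j (sigma a)).

Arguments permute v {j} sigma l _.

Lemma sum_permute (v : vars) (j : nat) (sigma : 'S_(psum lam j)) (i : nat) :
  \sum_(b < psum lam i) permute v sigma i b = \sum_(b < psum lam i) v i b.
Proof.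
rewrite /permute; case: (eqVneq i j) => [-> | ij].
  by rewrite dfwith_in [RHS](reindex_inj (@perm_inj _ sigma)).
by rewrite dfwith_out // eq_sym.
Qed.

(** At level l itself the shift moves to the index that the permutation sends to a;
the other levels commute with it. *)
Lemma permute_shift (l : nat) (v : vars) (a : 'I_(psum lam l)) j (sigma : 'S_(psum lam j)) :
  exists2 a', permute (shift_var v a s) sigma = shift_var (permute v sigma) a' s
    & permute v sigma l a' = v l a.
Proof.
case: (eqVneq j l) sigma => [-> | jl] sigma.
  exists ((sigma^-1)%g a); last by rewrite /permute dfwith_in permKV.
  apply: functional_extensionality_dep => i; rewrite /permute /shift_var.
  case: (eqVneq i l) => [-> | il].
    apply/funext => b; rewrite !dfwith_in.
    by rewrite (canF_eq (permK sigma)).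
  by rewrite !dfwith_out // eq_sym.
exists a; last by rewrite /permute dfwith_out.
apply: functional_extensionality_dep => i; rewrite /permute /shift_var.
case: (eqVneq i j) => [-> | ij].
  by rewrite dfwith_in [RHS]dfwith_out 1?eq_sym // dfwith_in dfwith_out // eq_sym.
rewrite [LHS]dfwith_out 1?eq_sym //.
case: (eqVneq i l) => [-> | il]; first by rewrite !dfwith_in dfwith_out.
by rewrite !dfwith_out // eq_sym.
Qed.

(** The multiplier depends on v only through v^(l)_a and through sums over whole
levels, so it is common to all terms of the symmetrization. *)
Lemma Symt_shift (k l : 'I_N) j (F : vars -> R[i]) :
  (forall v a, F (shift_var v a s)
     = kap ^+ (psum lam l.+1 + psum lam k) * E (@exponent k l v a) * F v) ->
  forall v a, Symt j F (shift_var v a s)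
     = kap ^+ (psum lam l.+1 + psum lam k) * E (@exponent k l v a) * Symt j F v.
Proof.
move=> hF v a; rewrite /Symt mulr_sumr; apply: eq_bigr => sigma _.
rewrite -/(permute _ sigma) -/(permute v sigma).
have [a' -> va'] := permute_shift v a sigma.
by rewrite hF /exponent va' !sum_permute.
Qed.

End Shift.

Definition level_const (j : 'I_N) : R[i] :=
  \prod_(a < psum lam j) \prod_(b < psum lam j.+1)
    (if idx I b == idx I a then br 1 / br (dyn I P j (idx I a)) else 1).

Lemma weightU_levels (v : vars) :
  weightU logq r I P v = level_prod br level_const v.
Proof.
apply: eq_bigr => j _; rewrite /grid /level_const /ratios -!big_split /=.
apply: eq_bigr => a _; congr (_ * _).
rewrite [X in X * _ * _]big_mkcond [X in _ * X * _]big_mkcond [X in _ * _ * X]big_mkcond.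
rewrite -!big_split /=; apply: eq_bigr => b _; rewrite /offset.
rewrite -!val_eqE /=.
move: br => f; move: (dyn I P j _) => d.
case: (ltngtP (idx I b) (idx I a)) => _ /=.
- by rewrite !mul1r mulr1.
- by rewrite !mul1r !mulr1 addr0.
- by rewrite !mulr1 mulrA.
Qed.

Lemma weight_shift (s kap : R[i]) (E : R[i] -> R[i])
    (k l : 'I_N) (v : vars) (a : 'I_(psum lam l)) :
  quasi_period br s kap E ->
  (forall i j m : 'I_N, P i j + P j m = P i m) ->
  l = k.+1 :> nat ->
  weight logq r I P (shift_var v a s)
  = kap ^+ (psum lam l.+1 + psum lam k) * E (exponent k v a)
    * weight logq r I P v.
Proof.
move=> qp hP hkl; rewrite /weight.
elim: (iota _ _) v a => [|j t IH] v a /=; last exact: Symt_shift.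
by rewrite !weightU_levels; exact: level_prod_shift.
Qed.

End Weight.

(* The colours l and l+1 of level l are the ordinals k and l, with l = k + 1. *)
Theorem proposition5p5 (R : realType) (q logq tau : R[i]) (r : R)
    (hq : 0 < `|q| < 1) (hlog : cexp logq = q) (hr : 0 < r)
    (htau : 2 * r%:C * logq = - (2 * ipi R) / tau)
    (N n : nat) (lam : 'I_N -> nat)
    (hlam : (\sum_(k < N) lam k)%N = n) (I : opart n lam)
    (P : 'I_N -> 'I_N -> R[i])
    (hP : forall i j m : 'I_N, P i j + P j m = P i m)
    (v : forall l : nat, 'I_(psum lam l) -> R[i])
    (hreg : weight_regular logq r I P v)
    (k l : 'I_N) (hkl : l = k.+1 :> nat) (a : 'I_(psum lam l)) :
  weight logq r I P (shift_var v a r%:C)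
    = (-1) ^+ (psum lam l.+1 + psum lam k) * weight logq r I P v
  /\
  weight logq r I P (shift_var v a (r%:C * tau))
    = (- cexp (- (ipi R * tau))) ^+ (psum lam l.+1 + psum lam k)
      * cexp (- (2 * ipi R / r%:C)
              * ((psum lam l.+1 + psum lam k)%:R * v l a
                 - \sum_(b < psum lam l.+1) v l.+1 b
                 - \sum_(c < psum lam k) v k c
                 - P k l - (lam l)%:R))
      * weight logq r I P v.
Proof.
have q1 : `|cexp logq| < 1 by rewrite hlog; case/andP: hq.
have p1 := norm_nome q1 hr.
have lq0 : logq != 0.
  by apply/eqP => lq; move: q1; rewrite lq cexp0 normr1 ltxx.
have rn0 := gt0_real_complex_neq0 hr.
split.
  have qp : quasi_period (brk logq r) r%:C (-1) (fun=> 1).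
    split.
    - by [].
    - by move=> *; rewrite mulr1.
    - by rewrite oppr_eq0 oner_eq0.
    - by rewrite sqrrN expr1n.
    - by move=> u; rewrite brk_shift_r // mulr1 mulN1r.
  by rewrite (weight_shift _ _ _ qp hP hkl) mulr1.
have qp : quasi_period (brk logq r) (r%:C * tau) (- cexp (- (ipi R * tau)))
    (fun u => cexp (- (2 * ipi R / r%:C) * u)).
  split.
  - by rewrite mulr0 cexp0.
  - by move=> x y; rewrite mulrDr cexpD.
  - by rewrite oppr_eq0 cexp_neq0.
  - by rewrite sqrrN expr2 -cexpD; congr cexp; field.
  - by move=> u; rewrite brk_shift_tau.
exact: (weight_shift _ _ _ qp hP hkl).
Qed.
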